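(* Let $f:[0,1]\to\mathbb{E}^1$ be a continuous fuzzy-valued function such that $f(y)\subseteq f(x)$ for all $x,y\in[0,1]$ with $x\le y$. Then, for all positive integers $n$, $$E_{n,f}\le (2n+2)\,\omega^{\mathcal F}\left(f,\frac1n\right).$$
   Context: Fuzzy numbers. $\mathbb{E}^1$ is the set of functions $u:\mathbb{R}\to[0,1]$ that are normal ($u(x_0)=1$ for some $x_0\in\mathbb{R}$), convex ($u(\lambda x+(1-\lambda)y)\ge\min\{u(x),u(y)\}$ for all $x,y\in\mathbb{R}$, $\lambda\in[0,1]$), upper semicontinuous, and such that $[u]_0:=\overline{\{x\in\mathbb{R}:u(x)>0\}}$ is compact. For $\alpha\in(0,1]$ put $[u]_\alpha:=\{x\in\mathbb{R}:u(x)\ge\alpha\}$. Each $[u]_\alpha$, $\alpha\in[0,1]$, is a compact interval, written $[u_\alpha^-,u_\alpha^+]$. Addition and multiplication by a scalar $k\in\mathbb{R}$ in $\mathbb{E}^1$ are defined level-wise: $[u+v]_\alpha=[u]_\alpha+[v]_\alpha$ (Minkowski sum), $[ku]_\alpha=k[u]_\alpha$. Metric. $d_\infty(u,v):=\sup_{\alpha\in[0,1]}\max\{|u_\alpha^--v_\alpha^-|,|u_\alpha^+-v_\alpha^+|\}$. $C([0,1],\mathbb{E}^1)$ is the set of functions $[0,1]\to\mathbb{E}^1$ continuous with respect to $d_\infty$, with the metric $D(f,g):=\sup_{x\in[0,1]}d_\infty(f(x),g(x))$. Fuzzy inclusion. $u\subseteq v$ means $[u]_\alpha\subseteq[v]_\alpha$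 for all $\alpha\in[0,1]$. Modulus of continuity. $\omega^{\mathcal F}(f,\delta):=\sup\{d_\infty(f(x),f(y)): x,y\in[0,1],\ |x-y|<\delta\}$. Approximation error. $\mathfrak{F}_n:=\left\{\sum_{i=0}^n\psi_i(x)u_i:\ \psi_i\in C([0,1],[0,1]),\ u_i\in\mathbb{E}^1,\ i=0,1,\dots,n\right\}$ (viewed as functions of $x\in[0,1]$ with values in $\mathbb{E}^1$), and $E_{n,f}:=\inf_{g\in\mathfrak{F}_n}D(f,g)$. *)

(* Defs.v *)
From HB Require Import structures.
From mathcomp Require Import all_boot all_order all_algebra.
From mathcomp Require Import all_classical all_reals all_analysis.
From mathcomp Require Import ring lra.

Set Implicit Arguments.
Unset Strict Implicit.
Unset Printing Implicit Defensive.
Import Order.TTheory GRing.Theory Num.Theory.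
Import numFieldNormedType.Exports.

Local Open Scope classical_set_scope.
Local Open Scope ring_scope.

Definition upper_semicontinuous (R : realType) (u : R -> R) : Prop :=
  forall x a, u x < a -> \forall y \near x, u y < a.

Record is_fuzzy_number (R : realType) (u : R -> R) : Prop := IsFuzzyNumber {
  fuzzy_itv : forall x, 0 <= u x <= 1 ;
  fuzzy_normal : exists x0, u x0 = 1 ;
  fuzzy_convex : forall x y l : R, 0 <= l <= 1 ->
    Num.min (u x) (u y) <= u (l * x + (1 - l) * y) ;
  fuzzy_usc : upper_semicontinuous u ;
  fuzzy_supp : compact (closure [set x | 0 < u x]) }.

(* The space E^1. *)
Record fuzzy (R : realType) := Fuzzy {
  fuzzy_fun :> R -> R ;
  fuzzyP : is_fuzzy_number fuzzy_fun }.

HB.instance Definition _ (R : realType) := gen_eqMixin (fuzzy R).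
HB.instance Definition _ (R : realType) := gen_choiceMixin (fuzzy R).

(* [u]_a; meaningful for a in [0, 1]. *)
Definition level (R : realType) (u : R -> R) (a : R) : set R :=
  if a == 0 then closure [set x | 0 < u x] else [set x | a <= u x].

(* u_a^- and u_a^+; see levelE. *)
Definition lo (R : realType) (u : R -> R) (a : R) : R := inf (level u a).
Definition hi (R : realType) (u : R -> R) (a : R) : R := sup (level u a).

Section Levels.
Variable R : realType.
Implicit Types (u v : fuzzy R) (a b x y z : R).

Lemma fuzzy_ext u v : u =1 v -> u = v.
Proof.
case: u v => [u Pu] [v Pv] /= /funext uv; subst v.
by congr Fuzzy; exact: Prop_irrelevance.
Qed.

Lemma level_pos u a : 0 < a -> level u a = [set x | a <= u x].
Proof. by move=> a0; rewrite /level gt_eqF. Qed.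

Lemma level0 u : level u 0 = closure [set x | 0 < u x].
Proof. by rewrite /level eqxx. Qed.

Lemma level_mono u a b : 0 <= a <= b -> level u b `<=` level u a.
Proof.
move=> /andP[a0 ab]; have [b0|b0] := eqVneq b 0.
  by have -> : a = b by lra.
have {}b0 : 0 < b by lra.
rewrite level_pos//; have [->|a0'] := eqVneq a 0.
  rewrite level0 => x /= bx; apply: subset_closure => /=; lra.
by rewrite level_pos; [move=> x /=|]; lra.
Qed.

Lemma level_neq0 u a : 0 <= a <= 1 -> level u a !=set0.
Proof.
move=> a01; have [x ux] := fuzzy_normal (fuzzyP u); exists x.
by apply: (level_mono a01); rewrite level_pos//= ux.
Qed.

Lemma level_closed u a : 0 <= a -> closed (level u a).
Proof.
rewrite le_eqVlt => /predU1P[<-|a0]; first by rewrite level0; exact: closed_closure.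
rewrite level_pos// -openC openE => x /= /negP; rewrite -ltNge => uxa.
have := fuzzy_usc (fuzzyP u) uxa; apply: filterS => y /= uya.
by apply/negP; rewrite -ltNge.
Qed.

Lemma level_compact u a : 0 <= a -> compact (level u a).
Proof.
move=> a0; apply: subclosed_compact; first exact: level_closed.
  exact: fuzzy_supp (fuzzyP u).
by rewrite -level0; apply: level_mono; rewrite lexx.
Qed.

Lemma fuzzy_between u x y z : x <= z <= y -> Num.min (u x) (u y) <= u z.
Proof.
move=> /andP[xz zy]; have [xy|xy] := eqVneq x y.
  have -> : z = x by lra.
  by rewrite ge_min lexx.
have d0 : 0 < y - x by lra.
pose l := (y - z) / (y - x).
have l01 : 0 <= l <= 1.
  rewrite /l divr_ge0 ?ler_pdivrMr//=; lra.
have -> : z = l * x + (1 - l) * y.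
  have ld : l * (y - x) = y - z by rewrite /l divfK// gt_eqF.
  have -> : l * x + (1 - l) * y = y - l * (y - x) by ring.
  by rewrite ld; ring.
exact: fuzzy_convex (fuzzyP u) _ _ _ l01.
Qed.

Lemma level_interval u a x y z : 0 <= a ->
  level u a x -> level u a y -> x <= z <= y -> level u a z.
Proof.
rewrite le_eqVlt => /predU1P[<-|a0]; last first.
  rewrite level_pos//= => ux uy xzy.
  by apply: le_trans (fuzzy_between u xzy); rewrite le_min ux.
rewrite level0 => cx cy /andP[].
rewrite le_eqVlt => /predU1P[<-//|xz]; rewrite le_eqVlt => /predU1P[->//|zy].
have [x' [ux' /= x'z]] := cx _ (lt_nbhsl xz).
have [y' [uy' /= zy']] := cy _ (lt_nbhsr zy).
apply: subset_closure => /=.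
have x'zy' : x' <= z <= y' by rewrite !ltW.
by apply: lt_le_trans (fuzzy_between u x'zy'); rewrite lt_min ux' uy'.
Qed.

Lemma level_has_sup u a : 0 <= a <= 1 -> has_sup (level u a).
Proof.
move=> /[dup] /(level_neq0 u) ne /andP[a0 _].
exact/compact_has_sup/level_compact.
Qed.

Lemma level_opp_compact u a : 0 <= a -> compact (-%R @` level u a).
Proof.
move=> a0; apply: continuous_compact; last exact: level_compact.
by apply: continuous_subspaceT => x; exact: opp_continuous.
Qed.

Lemma level_has_inf u a : 0 <= a <= 1 -> has_inf (level u a).
Proof.
move=> /[dup] /(level_neq0 u)[x ux] /andP[a0 _]; apply/has_inf_supN.
by apply: compact_has_sup; [exists (- x), x|exact: level_opp_compact].
Qed.

Lemma level_hi u a : 0 <= a <= 1 -> level u a (hi u a).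
Proof.
move=> a01; have [ne ub] := level_has_sup u a01.
have cl : closed (level u a) by apply: level_closed; case/andP: a01.
by rewrite [X in X _]((closure_id _).1 cl); exact: closure_sup.
Qed.

Lemma level_lo u a : 0 <= a <= 1 -> level u a (lo u a).
Proof.
move=> a01; have /has_inf_supN[ne ub] := level_has_inf u a01.
have cl : closed (-%R @` level u a).
  by apply: compact_closed; [exact: Rhausdorff|apply: level_opp_compact; case/andP: a01].
have := closure_sup ne ub; rewrite -((closure_id _).1 cl).
by case=> x ux; rewrite /lo /inf => <-; rewrite opprK.
Qed.

Lemma levelE u a : 0 <= a <= 1 -> level u a = `[lo u a, hi u a]%classic.
Proof.
move=> /[dup] a01 /andP[a0 _]; apply/seteqP; split => x /=; rewrite in_itv/=.
  move=> ux; rewrite ge_inf ?ub_le_sup//.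
  - by case: (level_has_sup u a01).
  - by case: (level_has_inf u a01).
exact: level_interval a0 (level_lo u a01) (level_hi u a01).
Qed.

Lemma lo_le_hi u a : 0 <= a <= 1 -> lo u a <= hi u a.
Proof. by move=> a01; have := level_lo u a01; rewrite levelE//= in_itv/= => /andP[]. Qed.

Lemma level_ext u v : (forall a, 0 <= a <= 1 -> level u a = level v a) -> u = v.
Proof.
suff H u' v' x : (forall a, 0 <= a <= 1 -> level u' a = level v' a) -> u' x <= v' x.
  by move=> uv; apply: fuzzy_ext => x; apply: le_anti; rewrite !H// => a /uv.
move=> uv; have /andP[] := fuzzy_itv (fuzzyP u') x.
rewrite le_eqVlt => /predU1P[<- _|ux0 ux1].
  by case/andP: (fuzzy_itv (fuzzyP v') x).
have : level u' (u' x) x by rewrite level_pos/=.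
have u01 : 0 <= u' x <= 1 by lra.
by rewrite uv// level_pos.
Qed.

Lemma end_ext u v :
  (forall a, 0 <= a <= 1 -> lo u a = lo v a /\ hi u a = hi v a) -> u = v.
Proof.
by move=> uv; apply: level_ext => a a01; rewrite !levelE//; case: (uv a a01) => -> ->.
Qed.

End Levels.

(* Stacking theorem: p and q are the endpoint functions of a fuzzy number as
   soon as p and - q satisfy [profile] and p 1 <= q 1. *)
Section Stacking.
Variable R : realType.
Implicit Types (u v : fuzzy R) (p q : R -> R).

Record profile p : Prop := Profile {
  profile_mono : forall a b, 0 <= a -> a <= b -> b <= 1 -> p a <= p b ;
  profile_left : forall a e, 0 < a <= 1 -> 0 < e ->
    exists2 b, 0 < b < a & p a - e < p b ;
  profile_0 : forall e, 0 < e -> exists2 b, 0 < b <= 1 & p b < p 0 + e }.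

Lemma profileD p q : profile p -> profile q -> profile (fun a => p a + q a).
Proof.
move=> [pm pl p0] [qm ql q0]; split.
- by move=> a b *; rewrite lerD// ?pm ?qm.
- move=> a e a01 e0; have e20 : 0 < e / 2 by rewrite divr_gt0.
  have [b1 b1a h1] := pl _ _ a01 e20; have [b2 b2a h2] := ql _ _ a01 e20.
  have h3 : p b1 <= p (Num.max b1 b2) by apply: pm; rewrite ?le_max ?ge_max ?lexx//; lra.
  have h4 : q b2 <= q (Num.max b1 b2) by apply: qm; rewrite ?le_max ?ge_max ?lexx ?orbT//; lra.
  exists (Num.max b1 b2); first by rewrite lt_max gt_max; lra.
  lra.
- move=> e e0; have e20 : 0 < e / 2 by rewrite divr_gt0.
  have [b1 b1a h1] := p0 _ e20; have [b2 b2a h2] := q0 _ e20.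
  have h3 : p (Num.min b1 b2) <= p b1 by apply: pm; rewrite ?ge_min ?le_min ?lexx//; lra.
  have h4 : q (Num.min b1 b2) <= q b2 by apply: qm; rewrite ?ge_min ?le_min ?lexx ?orbT//; lra.
  exists (Num.min b1 b2); first by rewrite lt_min ge_min; lra.
  lra.
Qed.

Lemma profile_cst c : profile (fun=> c).
Proof.
split => [//|a e a01 e0|e e0]; last by exists 1; lra.
by exists (a / 2); lra.
Qed.

Lemma profileZ k p : 0 <= k -> profile p -> profile (fun a => k * p a).
Proof.
rewrite le_eqVlt => /predU1P[<- _|k0 [pm pl p0]].
  have -> : (fun a => 0 * p a) = fun=> 0 by apply/funext => a; rewrite mul0r.
  exact: profile_cst.
split.
- by move=> *; rewrite ler_pM2l ?pm.
- move=> a e a01 e0; have [b ba h] := pl _ (e / k) a01 (divr_gt0 e0 k0).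
  by exists b => //; move: h; rewrite -(ltr_pM2l k0) mulrBr mulrCA divff ?gt_eqF// mulr1.
- move=> e e0; have [b ba h] := p0 (e / k) (divr_gt0 e0 k0).
  by exists b => //; move: h; rewrite -(ltr_pM2l k0) mulrDr mulrCA divff ?gt_eqF// mulr1.
Qed.

Lemma fuzzy_gt0_level u x : 0 < u x -> level u (u x) x.
Proof. by move=> ux; rewrite level_pos/=. Qed.

Lemma profile_lo u : profile (lo u).
Proof.
have mono a b : 0 <= a -> a <= b -> b <= 1 -> lo u a <= lo u b.
  move=> a0 ab b1; have a01 : 0 <= a <= 1 by lra.
  have /level_lo-/(_ u) ub : 0 <= b <= 1 by lra.
  have : level u a (lo u b) by apply: level_mono ub; lra.
  by rewrite levelE//= in_itv/= => /andP[].
split => // [a e a01 e0|e e0].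
- have a01' : 0 <= a <= 1 by lra.
  have : ~ level u a (lo u a - e) by rewrite levelE//= in_itv/=; lra.
  rewrite level_pos/=; last lra; move=> /negP; rewrite -ltNge => ua.
  pose x := lo u a - e; have ux := fuzzy_itv (fuzzyP u) x.
  have ba : 0 < (a + u x) / 2 < a by rewrite -/x in ua; lra.
  exists ((a + u x) / 2) => //; rewrite ltNge; apply/negP => lex.
  have b01 : 0 <= (a + u x) / 2 <= 1 by lra.
  have : level u ((a + u x) / 2) x.
    rewrite levelE//= in_itv/= lex/=.
    apply: (@le_trans _ _ (lo u a)); first by rewrite /x; lra.
    have := level_mono (b := a) (a := (a + u x) / 2) (u := u) _ (level_lo u a01').
    by rewrite levelE//= in_itv/= => /(_ _)/andP[]//; lra.
  rewrite level_pos/=; [rewrite -/x in ua; lra|lra].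
- have := @level_lo R u 0; rewrite lexx ler01 level0 => /(_ isT).
  have lte : lo u 0 < lo u 0 + e by lra.
  move=> /(_ _ (lt_nbhsl lte)) [x [/= ux0 xe]].
  have /andP[_ ux1] := fuzzy_itv (fuzzyP u) x.
  exists (u x); first by lra.
  apply: le_lt_trans xe; have := fuzzy_gt0_level ux0.
  by rewrite levelE//= ?in_itv/=; [case/andP|lra].
Qed.

Lemma profile_oppr_hi u : profile (fun a => - hi u a).
Proof.
have mono a b : 0 <= a -> a <= b -> b <= 1 -> hi u b <= hi u a.
  move=> a0 ab b1; have a01 : 0 <= a <= 1 by lra.
  have /level_hi-/(_ u) ub : 0 <= b <= 1 by lra.
  have : level u a (hi u b) by apply: level_mono ub; lra.
  by rewrite levelE//= in_itv/= => /andP[].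
split => [a b a0 ab b1|a e a01 e0|e e0]; first by rewrite lerN2 mono.
- have a01' : 0 <= a <= 1 by lra.
  have : ~ level u a (hi u a + e) by rewrite levelE//= in_itv/=; lra.
  rewrite level_pos/=; last lra; move=> /negP; rewrite -ltNge => ua.
  pose x := hi u a + e; have ux := fuzzy_itv (fuzzyP u) x.
  have ba : 0 < (a + u x) / 2 < a by rewrite -/x in ua; lra.
  exists ((a + u x) / 2) => //; rewrite -opprD ltrN2 ltNge; apply/negP => lex.
  have b01 : 0 <= (a + u x) / 2 <= 1 by lra.
  have : level u ((a + u x) / 2) x.
    rewrite levelE//= in_itv/= lex andbT.
    apply: (@le_trans _ _ (hi u a)); last by rewrite /x; lra.
    have := level_mono (b := a) (a := (a + u x) / 2) (u := u) _ (level_hi u a01').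
    by rewrite levelE//= in_itv/= => /(_ _)/andP[]//; lra.
  rewrite level_pos/=; [rewrite -/x in ua; lra|lra].
- have := @level_hi R u 0; rewrite lexx ler01 level0 => /(_ isT).
  have lte : hi u 0 - e < hi u 0 by lra.
  move=> /(_ _ (lt_nbhsr lte)) [x [/= ux0 xe]].
  have /andP[_ ux1] := fuzzy_itv (fuzzyP u) x.
  exists (u x); first by lra.
  rewrite -[e]opprK -opprD ltrN2; apply: lt_le_trans xe _.
  have := fuzzy_gt0_level ux0.
  by rewrite levelE//= ?in_itv/=; [case/andP|lra].
Qed.

Section Stack.
Variables p q : R -> R.
Hypotheses (pp : profile p) (pq : profile (fun a => - q a)) (pq1 : p 1 <= q 1).

Let S z : set R := [set a | a = 0 \/ 0 < a <= 1 /\ p a <= z <= q a].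
Let w z : R := sup (S z).

Let S_sup z : has_sup (S z).
Proof. by split; [exists 0; left|exists 1 => a [->|[/andP[]]]]. Qed.

Let w_ge0 z : 0 <= w z.
Proof. by apply: sup_upper_bound => //; left. Qed.

Let w_le1 z : w z <= 1.
Proof.
by apply: ge_sup; [case: (S_sup z)|move=> a [->|[/andP[]]]].
Qed.

Let q_mono a b : 0 <= a -> a <= b -> b <= 1 -> q b <= q a.
Proof. by move=> a0 ab b1; rewrite -lerN2 (profile_mono pq). Qed.

Let w_level a z : 0 < a <= 1 -> a <= w z <-> p a <= z <= q a.
Proof.
move=> a01; split => [aw|zpq]; last by apply: sup_upper_bound => //; right.
have key b : b < a -> 0 < b -> p b <= z <= q b.
  move=> ba b0; have bw : b < w z by lra.
  have [c [->|[c01 cz]] bc] := sup_gt (S_sup z).1 bw; first lra.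
  have := profile_mono pp (ltW b0) (ltW bc) (andP c01).2.
  have := q_mono (ltW b0) (ltW bc) (andP c01).2.
  lra.
apply/andP; split; rewrite leNgt; apply/negP => h.
- have e0 : 0 < p a - z by lra.
  have [b /andP[b0 ba] hb] := profile_left pp a01 e0.
  by have := key b ba b0; lra.
- have e0 : 0 < z - q a by lra.
  have [b /andP[b0 ba] hb] := profile_left pq a01 e0.
  by have := key b ba b0; lra.
Qed.

Let p0_le a : 0 < a <= 1 -> p 0 <= p a /\ q a <= q 0.
Proof. by move=> a01; rewrite q_mono ?(profile_mono pp)//; lra. Qed.

Let w_supp : closure [set x | 0 < w x] = `[p 0, q 0]%classic.
Proof.
apply/seteqP; split.
  rewrite closureE; apply: smallest_sub; first exact: itv_closed.
  move=> x /= wx0; have wx : 0 < w x <= 1 by rewrite wx0 w_le1.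
  have /(w_level x wx).1 := lexx (w x).
  by rewrite in_itv/=; have := p0_le wx; lra.
move=> z /=; rewrite in_itv/= => zpq B /nbhs_ballP[e /= e0 Be].
have [b1 b1a h1] := profile_0 pp e0; have [b2 b2a h2] := profile_0 pq e0.
pose b := Num.min b1 b2.
have b01 : 0 < b <= 1 by rewrite lt_min ge_min; lra.
have hp : p b <= p b1 by apply: (profile_mono pp); rewrite ?ge_min ?lexx//; lra.
have hq : q b2 <= q b by apply: q_mono; rewrite ?ge_min ?lexx ?orbT//; lra.
have pqb : p b <= q b.
  have hb1 : p b <= p 1 by apply: (profile_mono pp); lra.
  have hb2 : q 1 <= q b by apply: q_mono; lra.
  exact: le_trans hb1 (le_trans pq1 hb2).
have bw y : p b <= y <= q b -> 0 < w y.
  by move=> /(w_level y b01).2; apply: lt_le_trans; lra.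
have [zp|zp] := ltP z (p b).
  exists (p b); split; first by apply: bw; lra.
  by apply: Be; rewrite /ball/= ltr_norml; lra.
have [zq|zq] := ltP (q b) z.
  exists (q b); split; first by apply: bw; lra.
  by apply: Be; rewrite /ball/= ltr_norml; lra.
by exists z; split; [apply: bw; lra|apply: Be; exact: ballxx].
Qed.

Let w_fuzzy : is_fuzzy_number w.
Proof.
split.
- by move=> x; rewrite w_ge0 w_le1.
- exists (p 1); apply: le_anti; rewrite w_le1/=.
  by apply/w_level; rewrite ?lexx ?pq1// ltr01.
- move=> x y l l01; have [m0|m0] := leP (Num.min (w x) (w y)) 0.
    exact: le_trans m0 _.
  have m01 : 0 < Num.min (w x) (w y) <= 1 by rewrite m0 ge_min w_le1.
  set m := Num.min _ _ in m0 m01 *.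
  have /(w_level _ m01) hx : m <= w x by rewrite ge_min lexx.
  have /(w_level _ m01) hy : m <= w y by rewrite ge_min lexx orbT.
  by apply/w_level => //; nra.
- move=> x a wxa; have [a1|a1] := ltP 1 a.
    by near=> y; exact: le_lt_trans (w_le1 y) a1.
  have a01 : 0 < a <= 1 by rewrite a1 andbT (le_lt_trans (w_ge0 x)).
  have xpq : ~ p a <= x <= q a by move/(w_level x a01); lra.
  have cl : open (~` `[p a, q a]%classic) by rewrite openC; exact: itv_closed.
  have : nbhs x (~` `[p a, q a]%classic).
    by apply: open_nbhs_nbhs; split => //=; rewrite in_itv/=.
  apply: filterS => y /=; rewrite in_itv/= => ypq.
  by rewrite ltNge; apply/negP => /(w_level y a01).
- by rewrite w_supp; exact: segment_compact.
Unshelve. all: by end_near. Qed.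

Lemma stacking : exists w : fuzzy R, forall a, 0 <= a <= 1 -> level w a = `[p a, q a]%classic.
Proof.
exists (Fuzzy w_fuzzy) => a a01; have [->|a0] := eqVneq a 0.
  by rewrite level0/= w_supp.
rewrite level_pos; last lra.
apply/seteqP; split => x /=; rewrite in_itv/=; move/w_level; apply; lra.
Qed.

End Stack.
End Stacking.

Section Operations.
Variable R : realType.
Implicit Types (u v : fuzzy R) (k : R).

Lemma fadd_subproof u v : exists w : fuzzy R, forall a, 0 <= a <= 1 ->
  level w a = [set x + y | x in level u a & y in level v a].
Proof.
have [] := @stacking R (fun a => lo u a + lo v a) (fun a => hi u a + hi v a).
- by apply: profileD; exact: profile_lo.
- have -> : (fun a => - (hi u a + hi v a)) = fun a => - hi u a + - hi v a.
    by apply/funext => a; rewrite opprD.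
  by apply: profileD; exact: profile_oppr_hi.
- by rewrite lerD// lo_le_hi// ler01 lexx.
move=> w hw; exists w => a a01; rewrite hw// !levelE//.
have := lo_le_hi u a01; have := lo_le_hi v a01 => lv lu.
apply/seteqP; split => [z|_ [x /=+ [y /=+ <-]]] /=; rewrite !in_itv/=; last lra.
move=> hz; have [zl|zl] := leP (z - lo v a) (hi u a).
  by exists (z - lo v a); [|exists (lo v a)]; rewrite /= ?in_itv/=; lra.
by exists (hi u a); [|exists (z - hi u a)]; rewrite /= ?in_itv/=; lra.
Qed.

Lemma fscale_subproof k u : exists w : fuzzy R, forall a, 0 <= a <= 1 ->
  level w a = [set k * x | x in level u a].
Proof.
have [k0|k0] := leP 0 k.
- have [] := @stacking R (fun a => k * lo u a) (fun a => k * hi u a).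
  + exact/profileZ/profile_lo.
  + have -> : (fun a => - (k * hi u a)) = fun a => k * - hi u a.
      by apply/funext => a; rewrite mulrN.
    exact/profileZ/profile_oppr_hi.
  + by rewrite ler_wpM2l// lo_le_hi// ler01 lexx.
  move=> w hw; exists w => a a01; rewrite hw// !levelE//.
  have lu := lo_le_hi u a01.
  apply/seteqP; split => [z|_ [x /=+ <-]] /=; rewrite !in_itv/=; last nra.
  move=> hz; move: k0; rewrite [0 <= k]le_eqVlt => /predU1P[k0|k0].
    by rewrite -k0 in hz *; exists (lo u a); rewrite /= ?in_itv/=; lra.
  exists (z / k); last by rewrite mulrC divfK// gt_eqF.
  by rewrite /= in_itv/= ler_pdivlMr// ler_pdivrMr//; lra.
- have [] := @stacking R (fun a => k * hi u a) (fun a => k * lo u a).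
  + have -> : (fun a => k * hi u a) = fun a => - k * - hi u a.
      by apply/funext => a; rewrite mulrNN.
    by apply: profileZ; [lra|exact: profile_oppr_hi].
  + have -> : (fun a => - (k * lo u a)) = fun a => - k * lo u a.
      by apply/funext => a; rewrite mulNr.
    by apply: profileZ; [lra|exact: profile_lo].
  + by rewrite ler_wnM2l ?(ltW k0)// lo_le_hi// ler01 lexx.
  move=> w hw; exists w => a a01; rewrite hw// !levelE//.
  have lu := lo_le_hi u a01.
  apply/seteqP; split => [z|_ [x /=+ <-]] /=; rewrite !in_itv/=; last nra.
  move=> hz; exists (z / k); last by rewrite mulrC divfK// lt_eqF.
  by rewrite /= in_itv/= ler_ndivlMr// ler_ndivrMr//; lra.
Qed.

Lemma fzero_subproof : exists w : fuzzy R, forall a, 0 <= a <= 1 ->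
  level w a = [set 0].
Proof.
have [] := @stacking R (fun=> 0) (fun=> 0) => //.
- exact: profile_cst.
- exact: profile_cst.
by move=> w hw; exists w => a a01; rewrite hw// set_itv1.
Qed.

End Operations.

(* The operations are determined by their level sets, by [level_ext]. *)
Definition fadd (R : realType) (u v : fuzzy R) : fuzzy R :=
  projT1 (cid (fadd_subproof u v)).
Definition fscale (R : realType) (k : R) (u : fuzzy R) : fuzzy R :=
  projT1 (cid (fscale_subproof k u)).
Definition fzero (R : realType) : fuzzy R := projT1 (cid (fzero_subproof R)).

Section OperationsTheory.
Variable R : realType.
Implicit Types (u v : fuzzy R) (k a : R).

Lemma level_fadd u v a : 0 <= a <= 1 ->
  level (fadd u v) a = [set x + y | x in level u a & y in level v a].
Proof. by rewrite /fadd; case: cid => w /= /(_ a). Qed.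

Lemma level_fscale k u a : 0 <= a <= 1 ->
  level (fscale k u) a = [set k * x | x in level u a].
Proof. by rewrite /fscale; case: cid => w /= /(_ a). Qed.

Lemma level_fzero a : 0 <= a <= 1 -> level (fzero R) a = [set 0].
Proof. by rewrite /fzero; case: cid => w /= /(_ a). Qed.

Lemma faddA : associative (@fadd R).
Proof.
move=> u v w; apply: level_ext => a a01; rewrite !level_fadd//.
apply/seteqP; split => _ [x ux [y uy <-]].
  by case: uy => y' vy [z wz <-]; exists (x + y'); [exists x => //; exists y'|exists z; rewrite ?addrA].
by case: ux => x' ux [y' vy <-]; exists x' => //; exists (y' + y); [exists y' => //; exists y|rewrite addrA].
Qed.

Lemma faddC : commutative (@fadd R).
Proof.
move=> u v; apply: level_ext => a a01; rewrite !level_fadd//.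
by apply/seteqP; split => _ [x ux [y uy <-]]; exists y => //; exists x; rewrite // addrC.
Qed.

Lemma fadd0 : left_id (fzero R) (@fadd R).
Proof.
move=> u; apply: level_ext => a a01; rewrite level_fadd// level_fzero//.
apply/seteqP; split => [_ [_ -> [y uy <-]]|y uy]; first by rewrite add0r.
by exists 0 => //; exists y; rewrite ?add0r.
Qed.

End OperationsTheory.

HB.instance Definition _ (R : realType) :=
  GRing.isNmodule.Build (fuzzy R) (@faddA R) (@faddC R) (@fadd0 R).

(* d_infty *)
Definition dinf (R : realType) (u v : fuzzy R) : R :=
  sup [set Num.max `|lo u a - lo v a| `|hi u a - hi v a| | a in `[0, 1]%classic].

Section Metric.
Variable R : realType.
Implicit Types u v : fuzzy R.

Lemma dinf_has_sup u v :
  has_sup [set Num.max `|lo u a - lo v a| `|hi u a - hi v a| | a in `[0, 1]%classic].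
Proof.
split; first by exists (Num.max `|lo u 0 - lo v 0| `|hi u 0 - hi v 0|), 0; rewrite //= in_itv/= lexx ler01.
exists (`|lo u 0| + `|hi u 0| + `|lo v 0| + `|hi v 0|) => _ [a /=+ <-].
rewrite in_itv/= => a01; have a0 : 0 <= a by lra.
have a1 : a <= 1 by lra.
have lua := lo_le_hi u a01; have lva := lo_le_hi v a01.
have := profile_mono (profile_lo u) (lexx 0) a0 a1.
have := profile_mono (profile_lo v) (lexx 0) a0 a1.
have := profile_mono (profile_oppr_hi u) (lexx 0) a0 a1.
have := profile_mono (profile_oppr_hi v) (lexx 0) a0 a1.
have := ler_norm (lo u 0); have := ler_norm (lo v 0).
have := ler_norm (hi u 0); have := ler_norm (hi v 0).
have := ler_norm (- lo u 0); have := ler_norm (- lo v 0).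
have := ler_norm (- hi u 0); have := ler_norm (- hi v 0).
rewrite !normrN ge_max !ler_norml.
move: (lo u 0) (lo v 0) (hi u 0) (hi v 0) (lo u a) (lo v a) (hi u a) (hi v a) lua lva.
move=> *; lra.
Qed.

Lemma dinf_ge u v a : 0 <= a <= 1 ->
  `|lo u a - lo v a| <= dinf u v /\ `|hi u a - hi v a| <= dinf u v.
Proof.
move=> a01; have : Num.max `|lo u a - lo v a| `|hi u a - hi v a| <= dinf u v.
  by apply: sup_upper_bound; [exact: dinf_has_sup|exists a].
by rewrite ge_max => /andP.
Qed.

Lemma dinf_le u v e : (forall a, 0 <= a <= 1 ->
  `|lo u a - lo v a| <= e /\ `|hi u a - hi v a| <= e) -> dinf u v <= e.
Proof.
move=> h; apply: ge_sup; first by case: (dinf_has_sup u v).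
move=> _ [a /=+ <-]; rewrite in_itv/= => a01.
by have [h1 h2] := h a a01; rewrite ge_max h1 h2.
Qed.

Lemma dinfxx u : dinf u u = 0.
Proof.
apply: le_anti; rewrite dinf_le /=; last by move=> a _; rewrite !subrr normr0.
by have [|h _] := @dinf_ge u u 0; [rewrite lexx ler01|exact: le_trans h].
Qed.

Lemma dinf_sym u v : dinf u v = dinf v u.
Proof.
by apply: le_anti; rewrite !dinf_le// => a /dinf_ge h; rewrite distrC [X in _ /\ X <= _]distrC.
Qed.

Lemma dinf_triangle v u w : dinf u w <= dinf u v + dinf v w.
Proof.
apply: dinf_le => a a01; have [h1 h2] := dinf_ge u v a01.
have [h3 h4] := dinf_ge v w a01.
by split; [apply: le_trans (ler_distD (lo v a) _ _) (lerD h1 h3)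
          |apply: le_trans (ler_distD (hi v a) _ _) (lerD h2 h4)].
Qed.

Lemma dinf_eq0 u v : dinf u v = 0 -> u = v.
Proof.
move=> uv0; apply: end_ext => a a01; have := dinf_ge u v a01.
by rewrite uv0 !normr_le0 !subr_eq0 => -[/eqP -> /eqP ->].
Qed.

End Metric.

HB.instance Definition _ (R : realType) := @isMetric.Build R (fuzzy R)
  (@dinf R) (@dinfxx R) (@dinf_eq0 R) (@dinf_sym R) (@dinf_triangle R).

(* Functions on [0, 1] are represented by functions on R; their values outside
   [0, 1] are irrelevant, and continuity is relative to [0, 1]. On E^1 it refers
   to the metric structure given by [dinf]. *)
Definition cont01 (R : realType) (T : topologicalType) (f : R -> T) : Prop :=
  {within `[0, 1]%classic, continuous f}.

Lemma cont01P (R : realType) (f : R -> fuzzy R) : cont01 f <->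
  forall x e : R, 0 <= x <= 1 -> 0 < e -> exists2 d, 0 < d &
    forall y, 0 <= y <= 1 -> `|x - y| < d -> dinf (f x) (f y) < e.
Proof.
have cE : cont01 f <-> forall x : R, 0 <= x <= 1 ->
    f @ within `[0, 1]%classic (nbhs x) --> nbhs (f x).
  rewrite /cont01 subspace_continuousP.
  by split => h x x01; apply: h; move: x01; rewrite /= in_itv.
apply: (iff_trans cE); split => h x.
  move=> e x01 e0; have := h x x01 _ (nbhsx_ballx (f x) e e0).
  move=> /nbhs_ballP[d /= d0 hd]; exists d => // y y01 xyd.
  by have := hd y xyd; rewrite /= in_itv/= => /(_ y01); rewrite ballEmdist.
move=> x01 B /nbhs_ballP[e /= e0 eB]; have [d d0 hd] := h x e x01 e0.
apply/nbhs_ballP; exists d => //= y xyd; rewrite in_itv/= => y01.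
by apply: eB; rewrite ballEmdist/=; exact: hd.
Qed.

Definition finclude (R : realType) (u v : fuzzy R) : Prop :=
  forall a, 0 <= a <= 1 -> level u a `<=` level v a.

(* D, the modulus of continuity and E below are real suprema and infima: the
   sets are bounded for functions that are continuous on [0, 1]. *)
Definition Dist (R : realType) (f g : R -> fuzzy R) : R :=
  sup [set dinf (f x) (g x) | x in `[0, 1]%classic].

Definition modulus (R : realType) (f : R -> fuzzy R) (delta : R) : R :=
  sup [set d | exists x y, [/\ 0 <= x <= 1, 0 <= y <= 1, `|x - y| < delta
                             & d = dinf (f x) (f y)]].

Definition approximants (R : realType) (n : nat) : set (R -> fuzzy R) :=
  [set g | exists (psi : 'I_n.+1 -> R -> R) (u : 'I_n.+1 -> fuzzy R),
    (forall i, cont01 (psi i) /\ forall x, 0 <= x <= 1 -> 0 <= psi i x <= 1) /\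
    (forall x, 0 <= x <= 1 -> g x = \sum_(i < n.+1) fscale (psi i x) (u i))].

Definition approx_error (R : realType) (n : nat) (f : R -> fuzzy R) : R :=
  inf [set Dist f g | g in approximants n].

(* Main.v *)
Require Import Defs.
From mathcomp Require Import all_boot all_order all_algebra.
From mathcomp Require Import all_classical all_reals all_analysis.
From mathcomp Require Import ring lra.

(** The piecewise linear interpolant [g] of [f] at the nodes [i / n] lies in
    [approximants n], and [g x] is a convex combination of values of [f] at
    nodes at distance less than [1 / n] from [x].  Hence [Dist f g] is
    already at most [modulus f (1 / n)]. *)

Import Order.TTheory GRing.Theory Num.Theory.
Import numFieldNormedType.Exports.

Local Open Scope classical_set_scope.
Local Open Scope ring_scope.

(** * Endpoints of level sets under nonnegative combinations, and distances to convex
    combinations *)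

Section Endpoints.
Variable R : realType.
Implicit Types (u v : fuzzy R) (a k : R).

Lemma lo_le u a z : 0 <= a <= 1 -> level u a z -> lo u a <= z.
Proof. by move=> a01; rewrite levelE//= in_itv/= => /andP[]. Qed.

Lemma hi_ge u a z : 0 <= a <= 1 -> level u a z -> z <= hi u a.
Proof. by move=> a01; rewrite levelE//= in_itv/= => /andP[]. Qed.

Lemma lo_fadd u v a : 0 <= a <= 1 -> lo (fadd u v) a = lo u a + lo v a.
Proof.
move=> a01; apply: le_anti; apply/andP; split.
  apply: lo_le => //; rewrite level_fadd//.
  by exists (lo u a); [exact: level_lo|exists (lo v a) => //; exact: level_lo].
have := level_lo (fadd u v) a01; rewrite level_fadd// => -[x ux [y vy <-]].
by rewrite lerD ?lo_le.
Qed.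

Lemma hi_fadd u v a : 0 <= a <= 1 -> hi (fadd u v) a = hi u a + hi v a.
Proof.
move=> a01; apply: le_anti; apply/andP; split.
  have := level_hi (fadd u v) a01; rewrite level_fadd// => -[x ux [y vy <-]].
  by rewrite lerD ?hi_ge.
apply: hi_ge => //; rewrite level_fadd//.
by exists (hi u a); [exact: level_hi|exists (hi v a) => //; exact: level_hi].
Qed.

(** The sign condition matters: a negative factor would exchange the lower and upper endpoints. *)
Lemma lo_fscale k u a : 0 <= k -> 0 <= a <= 1 -> lo (fscale k u) a = k * lo u a.
Proof.
move=> k0 a01; apply: le_anti; apply/andP; split.
  apply: lo_le => //; rewrite level_fscale//.
  by exists (lo u a) => //; exact: level_lo.
have := level_lo (fscale k u) a01; rewrite level_fscale// => -[x ux <-].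
by rewrite ler_wpM2l ?lo_le.
Qed.

Lemma hi_fscale k u a : 0 <= k -> 0 <= a <= 1 -> hi (fscale k u) a = k * hi u a.
Proof.
move=> k0 a01; apply: le_anti; apply/andP; split.
  have := level_hi (fscale k u) a01; rewrite level_fscale// => -[x ux <-].
  by rewrite ler_wpM2l ?hi_ge.
apply: hi_ge => //; rewrite level_fscale//.
by exists (hi u a) => //; exact: level_hi.
Qed.

Lemma lo_fzero a : 0 <= a <= 1 -> lo (fzero R) a = 0.
Proof. by move=> a01; have := level_lo (fzero R) a01; rewrite level_fzero. Qed.

Lemma hi_fzero a : 0 <= a <= 1 -> hi (fzero R) a = 0.
Proof. by move=> a01; have := level_hi (fzero R) a01; rewrite level_fzero. Qed.

Lemma lo_sum (I : Type) (r : seq I) (w : I -> R) (u : I -> fuzzy R) a :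
  0 <= a <= 1 -> (forall i, 0 <= w i) ->
  lo (\sum_(i <- r) fscale (w i) (u i)) a = \sum_(i <- r) w i * lo (u i) a.
Proof.
move=> a01 w0; elim/big_ind2: _ => [|x1 x2 y1 y2 <- <-|i _].
- exact: lo_fzero.
- exact: lo_fadd.
- exact: lo_fscale.
Qed.

Lemma hi_sum (I : Type) (r : seq I) (w : I -> R) (u : I -> fuzzy R) a :
  0 <= a <= 1 -> (forall i, 0 <= w i) ->
  hi (\sum_(i <- r) fscale (w i) (u i)) a = \sum_(i <- r) w i * hi (u i) a.
Proof.
move=> a01 w0; elim/big_ind2: _ => [|x1 x2 y1 y2 <- <-|i _].
- exact: hi_fzero.
- exact: hi_fadd.
- exact: hi_fscale.
Qed.

End Endpoints.

(** Since the weights sum to 1, both [z] and [e] can be spread over the sum and compared term by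
    term. Terms of weight 0 vanish, so closeness is only asked where [w i != 0]; for hat weights
    these are the nearby nodes. *)
Lemma ler_dist_convex_sum (R : realType) (I : finType) (w y : I -> R) (z e : R) :
  (forall i, 0 <= w i) -> \sum_i w i = 1 ->
  (forall i, w i != 0 -> `|z - y i| <= e) -> `|z - \sum_i w i * y i| <= e.
Proof.
move=> w0 w1 yz; rewrite -[z in z - _]mul1r -[e]mul1r -w1 !mulr_suml.
rewrite -sumrB; apply: le_trans (ler_norm_sum _ _ _) _.
apply: ler_sum => i _; rewrite -mulrBr normrM (ger0_norm (w0 i)).
by have [->|wi0] := eqVneq (w i) 0; rewrite ?mul0r// ler_wpM2l ?yz.
Qed.

(** Endpoints of the combination are the combinations of the endpoints, so the real estimate applies
    at each level to both ends. *)
Lemma dinf_convex_sum (R : realType) (I : finType) (w : I -> R)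
    (u : I -> fuzzy R) (v : fuzzy R) (e : R) :
  (forall i, 0 <= w i) -> \sum_i w i = 1 ->
  (forall i, w i != 0 -> dinf v (u i) <= e) ->
  dinf v (\sum_i fscale (w i) (u i)) <= e.
Proof.
move=> w0 w1 ue; apply: dinf_le => a a01; rewrite lo_sum// hi_sum//.
by split; apply: ler_dist_convex_sum => // i /ue; apply: le_trans;
  have [] := dinf_ge v (u i) a01.
Qed.

(** * Hat functions: a continuous partition of unity on the grid of step [1 / n] *)

Section Hats.
Variable R : realType.
Implicit Types (t x : R) (n i : nat).

Definition clamp01 t : R := Num.min 1 (Num.max 0 t).

Lemma clamp01_itv t : 0 <= clamp01 t <= 1.
Proof. by rewrite /clamp01 le_min ge_min le_max ler01 !lexx. Qed.

Lemma clamp01_le0 t : t <= 0 -> clamp01 t = 0.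
Proof. by move=> t0; rewrite /clamp01 max_l// min_r. Qed.

Lemma clamp01_ge1 t : 1 <= t -> clamp01 t = 1.
Proof. by move=> t1; rewrite /clamp01 max_r ?min_l//; lra. Qed.

Lemma le_clamp01 s t : s <= t -> clamp01 s <= clamp01 t.
Proof.
by move=> st; rewrite /clamp01 le_min2 ?le_max2.
Qed.

Lemma continuous_clamp01 : continuous clamp01.
Proof.
by move=> t; apply: continuous_min; [exact: cvg_cst|apply: continuous_max; [exact: cvg_cst|exact: cvg_id]].
Qed.

(** Equal to [max 0 (1 - |n x - i|)]; written as a difference so that the sum
    over [i] telescopes. *)
Definition hat n i x : R := clamp01 (n%:R * x - i%:R + 1) - clamp01 (n%:R * x - i%:R).

Lemma hat_itv n i x : 0 <= hat n i x <= 1.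
Proof.
have := clamp01_itv (n%:R * x - i%:R); have := clamp01_itv (n%:R * x - i%:R + 1).
have := @le_clamp01 (n%:R * x - i%:R) (n%:R * x - i%:R + 1).
by rewrite /hat => /(_ ltac:(lra)); lra.
Qed.

Lemma sum_hat n x : 0 <= x <= 1 -> \sum_(i < n.+1) hat n i x = 1.
Proof.
move=> /andP[x0 x1]; have n0 := ler0n R n.
rewrite -(big_mkord xpredT (fun i => hat n i x)).
(* Only the boundary terms [clamp01 (n x + 1) = 1] and [clamp01 (n x - n) = 0] survive; their values
   use [0 <= x] and [x <= 1] respectively. *)
rewrite (telescope_sumr_eq (fun i => - clamp01 (n%:R * x - i%:R + 1)))//.
- rewrite opprK subr0 clamp01_le0; last by rewrite -natr1; nra.
  by rewrite clamp01_ge1; [lra|nra].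
- move=> i _; rewrite /hat opprK addrC; congr (- clamp01 _ + _).
  by rewrite -natr1; ring.
Qed.

Lemma hat_neq0 n i x : (0 < n)%N -> hat n i x != 0 -> `|x - i%:R / n%:R| < 1 / n%:R.
Proof.
move=> n0; have nR : 0 < n%:R :> R by rewrite ltr0n.
apply: contra_neqT; rewrite -leNgt => far.
have {far} : 1 <= `|n%:R * x - i%:R|.
  have -> : n%:R * x - i%:R = n%:R * (x - i%:R / n%:R) by field; rewrite gt_eqF.
  by rewrite normrM gtr0_norm// mulrC -ler_pdivrMr.
(* With [t = n x - i], either [t >= 1] and both clamps are 1, or [t <= -1] and both are 0; they
   cancel in each case. *)
rewrite ler_normr /hat => /orP[h|h].
  by rewrite !clamp01_ge1 ?subrr//; lra.
by rewrite !clamp01_le0 ?subrr//; lra.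
Qed.

Lemma cont01_hat n i : cont01 (hat n i).
Proof.
apply: continuous_subspaceT => x.
have aff : {for x, continuous (fun x => n%:R * x - i%:R : R)}.
  by apply: cvgB; [apply: cvgM; [exact: cvg_cst|exact: cvg_id]|exact: cvg_cst].
apply: cvgB.
  by apply: (continuous_comp (f := fun x => n%:R * x - i%:R + 1));
    [apply: cvgD => //; exact: cvg_cst|exact: continuous_clamp01].
by apply: (continuous_comp (f := fun x => n%:R * x - i%:R)) => //; exact: continuous_clamp01.
Qed.

End Hats.

Arguments hat {R} n i x.

(** * Boundedness of [f], and the real suprema behind the modulus and [Dist] *)

Section Modulus.
Variables (R : realType) (f : R -> fuzzy R).
Hypothesis f_cont : cont01 f.

(** The distance to [f 0] is a continuous real function by the reverse triangle inequality, so it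
    attains a maximum on the compact interval. *)
Lemma cont01_bounded :
  exists M : R, forall x, 0 <= x <= 1 -> dinf (f 0) (f x) <= M.
Proof.
have dist_cont : cont01 (fun x => dinf (f 0) (f x)).
  apply/subspace_continuousP => x; rewrite /= in_itv/= => x01.
  apply/cvgrPdist_lt => e e0; have [d d0 fd] := (cont01P f).1 f_cont x e x01 e0.
  apply/nbhs_ballP; exists d => //= y xyd; rewrite in_itv/= => y01.
  have := fd y y01 xyd; have := dinf_triangle (f x) (f 0) (f y).
  have := dinf_triangle (f y) (f 0) (f x); rewrite (dinf_sym (f y) (f x)).
  by rewrite /from_subspace ltr_norml; lra.
have [c _ cmax] := EVT_max ler01 dist_cont.
by exists (dinf (f 0) (f c)) => x x01; apply: cmax; rewrite in_itv.
Qed.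

(** A real [sup] dominates its set only when the set is bounded; going through [f 0] gives the bound
    [M + M]. *)
Lemma dinf_le_modulus (x y delta : R) : 0 <= x <= 1 -> 0 <= y <= 1 ->
  `|x - y| < delta -> dinf (f x) (f y) <= modulus f delta.
Proof.
move=> x01 y01 xy; have [M fM] := cont01_bounded.
apply: ub_le_sup; last by exists x, y.
exists (M + M) => _ [s [t [s01 t01 _ ->]]].
apply: le_trans (dinf_triangle (f 0) _ _) _.
by rewrite lerD ?fM// dinf_sym fM.
Qed.

End Modulus.

Lemma dinf_ge0 (R : realType) (u v : fuzzy R) : 0 <= dinf u v.
Proof.
have [|h _] := @dinf_ge R u v 0; first by rewrite lexx ler01.
exact: le_trans h.
Qed.

(** This bounds from below the set whose infimum is [approx_error]. It holds for arbitrary [g],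
    because [sup] takes the default value 0 when no supremum exists. *)
Lemma Dist_ge0 (R : realType) (f g : R -> fuzzy R) : 0 <= Dist f g.
Proof.
rewrite /Dist; set S := [set _ | _ in _].
have [hS|/sup_out->//] := pselect (has_sup S).
apply: le_trans (dinf_ge0 R (f 0) (g 0)) _.
by apply: sup_upper_bound => //; exists 0; rewrite //= in_itv/= lexx ler01.
Qed.

(** * The interpolant and the final estimate *)

Theorem theorem3p9 (R : realType) (f : R -> fuzzy R)
    (f_cont : cont01 f)
    (f_decr : forall x y : R, 0 <= x <= 1 -> 0 <= y <= 1 -> x <= y ->
      finclude (f y) (f x))
    (n : nat) (n_gt0 : (0 < n)%N) :
  approx_error n f <= (2 * n + 2)%:R * modulus f (1 / n%:R).
Proof.
have nR : 0 < n%:R :> R by rewrite ltr0n.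
set om := modulus f _.
have om_ge0 : 0 <= om.
  rewrite -[0](dinfxx (f 0)); apply: dinf_le_modulus => //.
  - by rewrite lexx ler01.
  - by rewrite lexx ler01.
  - by rewrite subrr normr0 divr_gt0.
(* As [om] is nonnegative and [2 n + 2 >= 1], it suffices to bound the error by [om] itself. *)
apply: (@le_trans _ _ om); last first.
  by rewrite ler_peMl// ler1n addn2.
pose g (x : R) : fuzzy R := \sum_(i < n.+1) fscale (hat n i x) (f (i%:R / n%:R)).
apply: (@le_trans _ _ (Dist f g)).
  apply: ge_inf; first by exists 0 => _ [h _ <-]; exact: Dist_ge0.
  exists g => //; exists (fun i : 'I_n.+1 => hat n i), (fun i : 'I_n.+1 => f (i%:R / n%:R)).
  by split => // i; split => [|x _]; [exact: cont01_hat|exact: hat_itv].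
apply: ge_sup; first by exists (dinf (f 0) (g 0)), 0; rewrite //= in_itv/= lexx ler01.
move=> _ [x /=+ <-]; rewrite in_itv/= => x01.
(* At a fixed [x] the hats are the convex weights, and a nonzero weight puts the node [i / n] within
   [1 / n] of [x], strictly, as the modulus requires. *)
apply: dinf_convex_sum => [i||i hi0]; [by case/andP: (hat_itv R n i x)|exact: sum_hat|].
apply: dinf_le_modulus => //; last exact: hat_neq0.
rewrite divr_ge0//= ler_pdivrMr// mul1r ler_nat.
by rewrite -ltnS ltn_ord.
Qed.
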